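(* Let $p\ge5$ be prime, $A,B\in\mathbb{N}$ and $\Delta=4A^3+27B^2$. For $k\ge1$ let \[ N_k=\#\bigl\{(x,y)\in(\mathbb{Z}/p^k\mathbb{Z})^2 : y^2=x^3+Ax+B\bigr\}. \] If $p\nmid\Delta$ then $N_k=p^{k-1}N_1$ for every $k\ge1$.
   Context: $\mathbb{N}$ denotes the natural numbers including $0$. *)

(* Defs.v *)
From mathcomp Require Export all_boot all_algebra.

Set Implicit Arguments.
Unset Strict Implicit.
Unset Printing Implicit Defensive.

(* 'Z_m is Z/mZ only for m > 1, which holds for m = p ^ k with p prime and
   k >= 1. *)
Definition curve_points (p k A B : nat) : {set 'Z_(p ^ k) * 'Z_(p ^ k)} :=
  [set P | P.2 ^+ 2 == P.1 ^+ 3 + A%:R * P.1 + B%:R]%R.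

Definition num_points (p k A B : nat) : nat := #|curve_points p k A B|.

Definition Delta (A B : nat) : nat := 4 * A ^ 3 + 27 * B ^ 2.

(* Main.v *)
Require Import Defs.
From mathcomp Require Import all_boot all_algebra.
From mathcomp Require Import ring zify.

(** Each point modulo [m = p ^ k] has exactly [p] lifts modulo [m * p]: writing
    a lift as [(x + m s, y + m t)] with [s, t] modulo [p], the Taylor expansion
    of the equation turns the lifting condition into an affine linear equation
    in [(s, t)] over ['F_p], whose linear part is the gradient of the curve
    equation at [(x, y)]. It does not vanish because [p] does not divide the
    discriminant, so the equation has [p] solutions. *)

Import GRing.Theory.

Section Lifting.

Local Open Scope ring_scope.

(** Working over the integers lets a single expression be reduced modulo [p ^ k], [p ^ k.+1] and
    [p], and lets a common factor [m] be cancelled. *)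
Definition weierstrass (A B : nat) (x y : int) : int :=
  y ^+ 2 - (x ^+ 3 + A%:R * x + B%:R).

Lemma intr_Zp_eq0 (n : nat) (z : int) :
  (1 < n)%N -> (z%:~R == 0 :> 'Z_n) = (n %| z)%Z.
Proof.
move=> n_gt1; have natE (i : nat) : (i%:R == 0 :> 'Z_n) = (n %| i)%N.
  by rewrite -val_eqE /= val_Zp_nat.
by case: z => i; rewrite dvdzE /= ?NegzE ?rmorphN ?oppr_eq0 natE.
Qed.

Lemma mem_curve_points (p k A B : nat) (P : 'Z_(p ^ k) * 'Z_(p ^ k)) :
  (1 < p ^ k)%N ->
  (P \in curve_points p k A B) =
  ((p ^ k)%N %| weierstrass A B (val P.1)%:Z (val P.2)%:Z)%Z.
Proof.
move=> n_gt1; rewrite inE -intr_Zp_eq0 // -subr_eq0 /weierstrass.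
rewrite !(rmorphB, rmorphD, rmorphM, rmorphXn, rmorph_nat) /=.
by rewrite -!pmulrn !natr_Zp.
Qed.

(** If [b = 0], the first coordinate is forced and the second is free; otherwise the first is free
    and determines the second. *)
Lemma card_affine_line (F : finFieldType) (a b c : F) :
  (a != 0) || (b != 0) ->
  #|[set v : F * F | a * v.1 + b * v.2 + c == 0]| = #|F|.
Proof.
have [b0 | b_neq0 _] := eqVneq b 0.
  rewrite b0 orbF => a_neq0.
  rewrite -(card_imset (f := fun t : F => (- c / a, t))); last by move=> ? ? [].
  apply: eq_card => -[s t]; rewrite inE /= mul0r addr0 addr_eq0 mulrC.
  apply/eqP/imsetP => [<- | [t' _ [-> _]]]; last by rewrite divfK.
  by exists t; rewrite // mulfK.
rewrite -(card_imset (f := fun s : F => (s, - (c + a * s) / b))).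
  apply: eq_card => -[s t]; rewrite inE /=.
  apply/eqP/imsetP => [e | [s' _ [-> ->]]]; last by field.
  exists s => //; congr pair; apply: (mulIf b_neq0); rewrite divfK //.
  by apply/eqP; rewrite -subr_eq0 -e; apply/eqP; ring.
by move=> ? ? [].
Qed.

(** At a point with zero gradient, [y = 0] and [A = - 3 x^2], hence [B = 2 x^3] and
    [4 A^3 + 27 B^2 = - 108 x^6 + 108 x^6 = 0]. *)
Lemma gradient_neq0 (F : fieldType) (A B x y : F) :
  2%:R != 0 :> F -> 4%:R * A ^+ 3 + 27%:R * B ^+ 2 != 0 ->
  y ^+ 2 = x ^+ 3 + A * x + B ->
  (- (3%:R * x ^+ 2 + A) != 0) || (2%:R * y != 0).
Proof.
move=> two_neq0 + e; apply: contraR; rewrite negb_or !negbK.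
rewrite oppr_eq0 mulf_eq0 (negPf two_neq0) /= => /andP[/eqP eA /eqP y0].
have {}eA : A = - (3%:R * x ^+ 2) by apply/eqP; rewrite -addr_eq0 addrC eA.
have eB : B = y ^+ 2 - (x ^+ 3 + A * x) by rewrite e; ring.
by rewrite eB eA y0; apply/eqP; ring.
Qed.

(** The Taylor terms of order at least two are multiples of [m ^ 2]. After division by [m] they
    vanish modulo [p], since [p] divides [m], and only the affine form is left. *)
Lemma weierstrass_lift (p m A B : nat) (x y s t c : int) :
  prime p -> (p %| m)%N -> (0 < m)%N -> weierstrass A B x y = c * m%:Z ->
  ((m * p)%N %| weierstrass A B (x + m%:Z * s) (y + m%:Z * t))%Z =
  (- (3%:R * x%:~R ^+ 2 + A%:R) * s%:~R + 2%:R * y%:~R * t%:~R + c%:~R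
     == 0 :> 'F_p).
Proof.
move=> p_pr /dvdnP[q mE] m_gt0 e.
(* [r] is the Taylor remainder divided by [m ^ 2]; [l] is the affine form before reduction modulo
   [p]. *)
pose r : int := t ^+ 2 - (3%:R * x * s ^+ 2 + m%:Z * s ^+ 3).
pose l : int := - (3%:R * x ^+ 2 + A%:R) * s + 2%:R * y * t + c.
have -> : weierstrass A B (x + m%:Z * s) (y + m%:Z * t) =
          m%:Z * (l + r * q%:Z * p%:Z).
  transitivity (weierstrass A B x y + m%:Z * (l - c + r * m%:Z)).
    by rewrite /weierstrass /l /r; ring.
  by rewrite e mE PoszM; ring.
rewrite PoszM dvdz_mul2l; last by lia.
rewrite (dvdz_pcharf (pchar_Fp p_pr)) rmorphD (rmorphM _ _ p%:Z) /=.
rewrite -[p%:~R]pmulrn pchar_Fp_0 // mulr0 addr0 /l.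
by rewrite !(rmorphD, rmorphN, rmorphM, rmorphXn, rmorph_nat).
Qed.


(** The modulus [n] is a separate parameter so that the lift can land in ['Z_(p ^ k.+1)], whose
    modulus is written differently from [m * p]. *)
Definition Zp_lift (p m n : nat) (u : 'Z_m * 'F_p) : 'Z_n :=
  inZp (u.1 + m * u.2)%N.

Lemma ltn_Zp (n : nat) (x : 'Z_n) : (1 < n)%N -> (x < n)%N.
Proof. by move=> n_gt1; have := ltn_ord x; rewrite [ltnRHS]Zp_cast. Qed.

Lemma ltn_Fp (p : nat) (x : 'F_p) : prime p -> (x < p)%N.
Proof. by move=> p_pr; have := ltn_ord x; rewrite [ltnRHS]Fp_cast. Qed.

Lemma val_Zp_lift (p m n : nat) (u : 'Z_m * 'F_p) :
  prime p -> (1 < m)%N -> n = (m * p)%N ->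
  val (Zp_lift p m n u) = (u.1 + m * u.2)%N.
Proof.
move=> p_pr m_gt1 ->; have p_gt1 := prime_gt1 p_pr.
have := ltn_Zp _ u.1 m_gt1; have := ltn_Fp _ u.2 p_pr => u2_lt u1_lt.
by rewrite /= [X in (_ %% X)%N]Zp_cast ?modn_small //; nia.
Qed.

Lemma Zp_lift_bij (p m n : nat) :
  prime p -> (1 < m)%N -> n = (m * p)%N -> bijective (Zp_lift p m n).
Proof.
move=> p_pr m_gt1 nE; have p_gt1 := prime_gt1 p_pr.
(* Both sides have [m * p] elements, so it suffices that remainder and quotient by [m] are
   unique. *)
apply: inj_card_bij; last first.
  by rewrite card_prod !card_ord Fp_cast // !Zp_cast //; nia.
move=> u v /(congr1 val); rewrite !val_Zp_lift // => e.
have u1 := ltn_Zp _ u.1 m_gt1; have v1 := ltn_Zp _ v.1 m_gt1.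
have e1 : u.1 = v.1.
  apply: val_inj; move: (congr1 (modn^~ m) e) => /=.
  by rewrite !(mulnC m) ![(_ + _ * m)%N]addnC !modnMDl !modn_small.
apply: injective_projections => //; apply: val_inj; move: e.
by rewrite e1 => /addnI/eqP; rewrite eqn_pmul2l ?(ltnW m_gt1) // => /eqP.
Qed.

Lemma num_pointsS (p k A B : nat) :
  prime p -> (2 < p)%N -> ~~ (p %| Delta A B)%N -> (0 < k)%N ->
  num_points p k.+1 A B = (num_points p k A B * p)%N.
Proof.
move=> p_pr p_gt2 p_ndvd k_gt0; have p_gt1 := prime_gt1 p_pr.
have m_gt1 : (1 < p ^ k)%N by rewrite -{1}(expn0 p) ltn_exp2l.
have n_gt1 : (1 < p ^ k.+1)%N by rewrite -{1}(expn0 p) ltn_exp2l.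
have dvd_pm : (p %| p ^ k)%N by exact: dvdn_exp.
have natFp0 (i : nat) : (i%:R == 0 :> 'F_p) = (p %| i)%N.
  by rewrite -(dvdn_pcharf (pchar_Fp p_pr)).
set m := (p ^ k)%N in m_gt1 dvd_pm *.
pose lift := Zp_lift p m (p ^ k.+1).
have lift_bij : bijective lift by apply: Zp_lift_bij; rewrite // expnSr.
pose lift2 (w : ('Z_m * 'F_p) * ('Z_m * 'F_p)) := (lift w.1, lift w.2).
pose base (w : ('Z_m * 'F_p) * ('Z_m * 'F_p)) := (w.1.1, w.2.1).
pose f (x y : int) := weierstrass A B x y.
have lift2_bij : bijective lift2.
  case: lift_bij => g gK Kg.
  by exists (fun P => (g P.1, g P.2)) => -[a b]; rewrite /lift2 /= ?gK ?Kg.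
have lift_mem w : (lift2 w \in curve_points p k.+1 A B) =
    ((m * p)%N %| f ((val w.1.1)%:Z + m%:Z * (val w.1.2)%:Z)
                   ((val w.2.1)%:Z + m%:Z * (val w.2.2)%:Z))%Z.
  by rewrite mem_curve_points // !val_Zp_lift ?expnSr // !PoszD !PoszM.
(* Passing from a lift to its base point changes [f] by a multiple of [m], so divisibility by [m] is
   preserved. *)
have base_mem w : lift2 w \in curve_points p k.+1 A B ->
    base w \in curve_points p k A B.
  rewrite lift_mem mem_curve_points //= -/m => /(dvdz_trans _).
  move/(_ m%:Z); rewrite PoszM dvdz_mulr // => /(_ isT).
  have -> (x y s t : int) : f (x + m%:Z * s) (y + m%:Z * t) = f x y +
      (2%:R * y * t + m%:Z * t ^+ 2 - (3%:R * x ^+ 2 * s + A%:R * s +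
       3%:R * x * m%:Z * s ^+ 2 + m%:Z ^+ 2 * s ^+ 3)) * m%:Z.
    by rewrite /f /weierstrass; ring.
  by rewrite rpredDr // dvdz_mull.
have fiber Q : Q \in curve_points p k A B ->
    #|[set w | (lift2 w \in curve_points p k.+1 A B) && (base w == Q)]| = p.
  case: Q => x y; rewrite mem_curve_points //= -/m => /dvdzP[c cE].
  pose a : 'F_p := - (3%:R * (val x)%:R ^+ 2 + A%:R).
  pose b : 'F_p := 2%:R * (val y)%:R.
  rewrite -[RHS](card_Fp p_pr) -(@card_affine_line _ a b c%:~R); last first.
    apply: (@gradient_neq0 _ _ B%:R).
    - by rewrite natFp0; apply: contraL p_gt2 => /dvdn_leq; rewrite -leqNgt; apply.
    - by rewrite -!natrX -!natrM -natrD natFp0.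
    (* Since [0 < k], the curve equation modulo [p ^ k] also holds modulo [p]. *)
    - apply/eqP; rewrite -subr_eq0; have := congr1 (intr : int -> 'F_p) cE.
      rewrite /weierstrass !(rmorphB, rmorphD, rmorphM, rmorphXn, rmorph_nat) /=.
      rewrite -!pmulrn => ->.
      have /eqP -> : p%:R == 0 :> 'F_p by rewrite natFp0.
      by rewrite expr0n eqn0Ngt k_gt0 mulr0.
  (* Over the fixed base point [(x, y)], a lift amounts to its pair of leading digits [(s, t)]. *)
  rewrite -(card_imset (f := fun v : 'F_p * 'F_p => ((x, v.1), (y, v.2))));
    last by move=> [? ?] [? ?] [-> ->].
  have lift_eq (s t : 'F_p) :
      ((m * p)%N %| f ((val x)%:Z + m%:Z * (val s)%:Z)
                      ((val y)%:Z + m%:Z * (val t)%:Z))%Z =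
      (a * s + b * t + c%:~R == 0).
    rewrite /f (weierstrass_lift _ _ _ _ _ _ _ _ c) ?(ltnW m_gt1) //.
    by rewrite -!pmulrn !natr_Zp.
  apply: eq_card => -[[x' s] [y' t]]; rewrite [LHS]inE lift_mem.
  apply/andP/imsetP => /= [[/[swap] /eqP[-> ->]] | [[s' t'] + [-> -> -> ->]]].
    by move=> st; exists (s, t); rewrite // inE -lift_eq.
  by rewrite inE -lift_eq /= => st; split.
(* The points are counted through [lift2] and grouped by base point, each group having [p] elements
   by [fiber]. *)
rewrite /num_points -(on_card_preimset (f := lift2)); last exact: onW_bij.
rewrite -sum1_card (partition_big base (mem (curve_points p k A B))) /=; last first.
  by move=> w; rewrite inE => /base_mem.
rewrite -sum_nat_const; apply: eq_bigr => Q Qin; rewrite -[RHS](fiber Q Qin).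
by rewrite sum1dep_card; apply: eq_card => w; rewrite !inE.
Qed.

End Lifting.

Theorem theorem9 (p A B : nat) (p_prime : prime p) (p_ge5 : 5 <= p)
    (p_ndvd : ~~ (p %| Delta A B)) (k : nat) (k_ge1 : 1 <= k) :
  num_points p k A B = p ^ (k - 1) * num_points p 1 A B.
Proof.
case: k k_ge1 => // k _; rewrite subn1 /=.
elim: k => [|k IHk]; first by rewrite mul1n.
by rewrite num_pointsS ?(leq_trans _ p_ge5) // IHk expnSr mulnAC.
Qed.
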